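(* Let $\Lambda\in\mathrm{CMin}$ be a compact minimal set of a $C^0$ flow on a generalized Peano continuum $M$. If any of the following three conditions holds, then $\Lambda\in\mathrm{cl}_H\,\mathcal{U}$, i.e. every neighbourhood of $\Lambda$ in $M$ contains Lyapunov unstable compact minimal sets: (1) $\mathrm{CMin}$ is not locally connected at $\Lambda$; (2) $\Lambda$ has no locally connected neighbourhood in $\mathrm{CMin}$; (3) $\Lambda$ has no compact neighbourhood in $\mathrm{CMin}$.
   Context: A generalized Peano continuum is a locally compact, connected and locally connected metric space. A $C^0$ flow on $M$ is a continuous action of $(\mathbb{R},+)$ on $M$. A minimal set is a nonempty closed invariant set containing no smaller nonempty closed invariant set. $\mathrm{CMin}$ is the set of all compact minimal sets of the flow, endowed with the Hausdorff metric $d_H$; $\mathrm{cl}_H$ is closure in $[\mathrm{CMin},d_H]$. A neighbourhood of a set $Y\subset M$ is a set whose interior contains $Y$. A nonempty compact invariant set $K$ is (Lyapunov) stable if every neighbourhood of $K$ contains a positively invariant neighbourhood of $K$; otherwise (Lyapunov) unstable. $\mathcal{U}$ is the set of unstable compact minimal sets. *)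

(* Defs.v *)
(* MathComp-Analysis *)
From HB Require Import structures.
From mathcomp Require Import all_boot all_order all_algebra.
From mathcomp Require Import all_classical all_reals all_analysis.

Set Implicit Arguments.
Unset Strict Implicit.
Unset Printing Implicit Defensive.

Import Order.TTheory GRing.Theory Num.Theory.
Import numFieldNormedType.Exports.

Local Open Scope classical_set_scope.
Local Open Scope ring_scope.

(** Neighbourhoods are not required to be open: a neighbourhood of a point or
    of a set is any set whose interior contains it. *)

Definition locally_connected_at (T : topologicalType) (x : T) :=
  forall U : set T, nbhs x U ->
    exists V : set T, [/\ nbhs x V, V `<=` U & connected V].

Definition locally_connected (T : topologicalType) :=
  forall x : T, locally_connected_at x.

Definition generalized_peano_continuum (R : realType) (M : metricType R) :=
  [/\ locally_compact [set: M], connected [set: M] & locally_connected M].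

Section flows.
Context {R : realType} {M : metricType R}.
Implicit Types (phi : R -> M -> M) (K N : set M).

Definition C0_flow phi :=
  [/\ continuous (fun p : R * M => phi p.1 p.2),
      forall x, phi 0 x = x
    & forall s t x, phi (s + t) x = phi s (phi t x)].

Definition flow_invariant phi K := forall t x, K x -> K (phi t x).

Definition positively_invariant phi K :=
  forall t x, 0 <= t -> K x -> K (phi t x).

Definition minimal_set phi K :=
  [/\ K !=set0, closed K, flow_invariant phi K
    & forall L : set M, L !=set0 -> closed L -> flow_invariant phi L ->
        L `<=` K -> L = K].

Definition compact_minimal_set phi K := compact K /\ minimal_set phi K.

(** Stability and instability are only meant for nonempty compact invariant
    sets [K]; below they are only applied to compact minimal sets. *)
Definition lyapunov_stable phi K :=
  forall N, K `<=` N° ->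
    exists P : set M, [/\ K `<=` P°, P `<=` N & positively_invariant phi P].

Definition lyapunov_unstable phi K := ~ lyapunov_stable phi K.

End flows.

Section hausdorff_distance.
Context {R : realType} {M : metricType R}.
Implicit Types (x : M) (A B C : set M).

Definition dist_to_set x A : R := inf [set mdist x a | a in A].

(** The real-valued [sup] and [inf] are the intended ones for nonempty compact
    sets, where they range over nonempty bounded sets of reals. *)
Definition hausdorff_excess A B : R := sup [set dist_to_set a B | a in A].

Definition hausdorff_dist A B : R :=
  Num.max (hausdorff_excess A B) (hausdorff_excess B A).

Lemma has_lbound_mdist x A : has_lbound [set mdist x a | a in A].
Proof. by exists 0 => _ [a _ <-]; exact: mdist_ge0. Qed.

Lemma dist_to_set_le x A a : A a -> dist_to_set x A <= mdist x a.
Proof. by move=> Aa; apply: ge_inf; [exact: has_lbound_mdist|exists a]. Qed.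

Lemma dist_to_set_ge0 x A : A !=set0 -> 0 <= dist_to_set x A.
Proof.
move=> [a Aa]; apply: lb_le_inf; first by exists (mdist x a), a.
by move=> _ [b _ <-]; exact: mdist_ge0.
Qed.

Lemma dist_to_set_lt x A e : A !=set0 -> dist_to_set x A < e ->
  exists2 a, A a & mdist x a < e.
Proof.
move=> [a Aa] /inf_lt [|_ [b Ab <-] be]; last by exists b.
by exists (mdist x a), a.
Qed.

Lemma compact_mdist_bounded x A : compact A ->
  exists r : R, forall a, A a -> mdist x a < r.
Proof.
move=> /compact_near_coveringP/(_ _ (pinfty_nbhs R)
  (fun r a => mdist x a < r) _) cA.
have : \forall r \near +oo, A `<=` [set a | mdist x a < r].
  apply: cA => a Aa; exists (ball a 1, [set r | mdist x a + 1 < r]) => /=.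
    split; first exact: nbhsx_ballx.
    by apply: nbhs_pinfty_gt; rewrite num_real.
  move=> [b r] /= [ab ar]; apply: (le_lt_trans (metric_triangle x a b)).
  apply: le_lt_trans ar; rewrite lerD2l.
  by move: ab; rewrite ballEmdist => /ltW.
by move=> /filter_ex [r Ar]; exists r.
Qed.

Lemma has_sup_excess A B : A !=set0 -> compact A -> B !=set0 ->
  has_sup [set dist_to_set a B | a in A].
Proof.
move=> [a Aa] cA [b Bb]; split; first by exists (dist_to_set a B), a.
have [r Ar] := compact_mdist_bounded b cA.
exists r => _ [a' Aa' <-]; apply: le_trans (ltW (Ar _ Aa')).
by rewrite metric_sym; exact: dist_to_set_le.
Qed.

Lemma hausdorff_excess_ub A B a : A !=set0 -> compact A -> B !=set0 -> A a ->
  dist_to_set a B <= hausdorff_excess A B.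
Proof.
move=> A0 cA B0 Aa; apply: ub_le_sup; last by exists a.
by have [] := has_sup_excess A0 cA B0.
Qed.

Lemma hausdorff_excess_le A B r : A !=set0 ->
  (forall a, A a -> dist_to_set a B <= r) -> hausdorff_excess A B <= r.
Proof.
move=> [a Aa] Ar; apply: ge_sup; first by exists (dist_to_set a B), a.
by move=> _ [a' Aa' <-]; exact: Ar.
Qed.

Lemma hausdorff_excess_ge0 A B : A !=set0 -> compact A -> B !=set0 ->
  0 <= hausdorff_excess A B.
Proof.
move=> A0 cA B0; have [a Aa] := A0.
exact: le_trans (dist_to_set_ge0 a B0) (hausdorff_excess_ub A0 cA B0 Aa).
Qed.

Lemma hausdorff_excess_triangle B A C :
  A !=set0 -> compact A -> B !=set0 -> compact B -> C !=set0 ->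
  hausdorff_excess A C <= hausdorff_excess A B + hausdorff_excess B C.
Proof.
move=> A0 cA B0 cB C0; apply: hausdorff_excess_le => // a Aa.
apply/ler_addgt0Pr => e e0.
have [b Bb ab] : exists2 b, B b & mdist a b < hausdorff_excess A B + e / 2.
  apply: dist_to_set_lt => //.
  by rewrite (le_lt_trans (hausdorff_excess_ub A0 cA B0 Aa))// ltrDl divr_gt0.
have [c Cc bc] : exists2 c, C c & mdist b c < hausdorff_excess B C + e / 2.
  apply: dist_to_set_lt => //.
  by rewrite (le_lt_trans (hausdorff_excess_ub B0 cB C0 Bb))// ltrDl divr_gt0.
apply: (le_trans (dist_to_set_le a Cc)).
apply: (le_trans (metric_triangle a b c)).
by rewrite (splitr e) addrACA lerD// ltW.
Qed.

Lemma hausdorff_excess_eq0 A B : A !=set0 -> compact A -> B !=set0 ->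
  closed B -> hausdorff_excess A B = 0 -> A `<=` B.
Proof.
move=> A0 cA B0 clB AB0 a Aa; apply: clB => U.
rewrite -(@metricType_numDomainType.filter_from_mdist_nbhs _ M).
move=> [e /= e0 aeU].
have [|b Bb ab] := @dist_to_set_lt a B e B0; last by exists b; split => //; exact: aeU.
by apply: le_lt_trans e0; rewrite -AB0; exact: hausdorff_excess_ub.
Qed.

Lemma hausdorff_excessxx A : A !=set0 -> hausdorff_excess A A = 0.
Proof.
move=> A0; suff AE a : A a -> dist_to_set a A = 0.
  have [a Aa] := A0; rewrite /hausdorff_excess (_ : image _ _ = [set 0]) ?sup1//.
  apply/seteqP; split=> [_ [b /AE -> <-]//|_ ->].
  by exists a => //; exact: AE.
move=> Aa; apply/eqP; rewrite eq_le dist_to_set_ge0// andbT.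
by rewrite -(mdistxx a); exact: dist_to_set_le.
Qed.

End hausdorff_distance.

(** The space CMin of compact minimal sets, with the Hausdorff metric. *)
Section cmin.
Context {R : realType} {M : metricType R}.

Record cmin (phi : R -> M -> M) := CMin {
  cmin_set :> set M ;
  cminP : compact_minimal_set phi cmin_set }.

Variable phi : R -> M -> M.

Lemma cmin_inj (K L : cmin phi) : cmin_set K = cmin_set L -> K = L.
Proof.
by case: K L => [K Kp] [L Lp] /= KL; subst L; congr CMin; exact: Prop_irrelevance.
Qed.

Lemma cmin_nonempty (K : cmin phi) : cmin_set K !=set0.
Proof. by have [_ []] := cminP K. Qed.

Lemma cmin_compact (K : cmin phi) : compact K.
Proof. by have [] := cminP K. Qed.

Lemma cmin_closed (K : cmin phi) : closed K.
Proof. by have [_ []] := cminP K. Qed.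

#[local] Hint Resolve cmin_nonempty cmin_compact cmin_closed : core.

Definition cmin_dist (K L : cmin phi) : R := hausdorff_dist K L.

Lemma cmin_distxx K : cmin_dist K K = 0.
Proof. by rewrite /cmin_dist /hausdorff_dist hausdorff_excessxx// maxxx. Qed.

Lemma cmin_dist_positivity K L : cmin_dist K L = 0 -> K = L.
Proof.
move=> KL; apply: cmin_inj.
have KL0 : hausdorff_excess K L <= 0 /\ hausdorff_excess L K <= 0.
  by rewrite -KL /cmin_dist /hausdorff_dist !le_max !lexx orbT.
have [KL1 LK1] := KL0.
by apply/seteqP; split; apply: hausdorff_excess_eq0 => //;
  apply/eqP; rewrite eq_le ?KL1 ?LK1 hausdorff_excess_ge0.
Qed.

Lemma cmin_dist_sym K L : cmin_dist K L = cmin_dist L K.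
Proof. by rewrite /cmin_dist /hausdorff_dist maxC. Qed.

Lemma cmin_dist_triangle L K N :
  cmin_dist K N <= cmin_dist K L + cmin_dist L N.
Proof.
rewrite /cmin_dist /hausdorff_dist ge_max; apply/andP; split.
  apply: (le_trans (@hausdorff_excess_triangle _ _ L _ _ _ _ _ _ _)) => //.
  by rewrite lerD// le_max lexx.
apply: (le_trans (@hausdorff_excess_triangle _ _ L _ _ _ _ _ _ _)) => //.
by rewrite addrC lerD// le_max lexx orbT.
Qed.

HB.instance Definition _ := gen_eqMixin (cmin phi).
HB.instance Definition _ := gen_choiceMixin (cmin phi).
HB.instance Definition _ := @isMetric.Build R (cmin phi) cmin_dist
  cmin_distxx cmin_dist_positivity cmin_dist_sym cmin_dist_triangle.

Definition unstable_cmin : set (cmin phi) :=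
  [set K : cmin phi | lyapunov_unstable phi K].

End cmin.

Arguments unstable_cmin {R M} phi.

(* Main.v *)
Require Import Defs.
From mathcomp Require Import all_boot all_order all_algebra.
From mathcomp Require Import all_classical all_reals all_analysis.
Import Order.TTheory GRing.Theory Num.Theory.
Import numFieldNormedType.Exports.
Set Implicit Arguments.
Unset Strict Implicit.
Unset Printing Implicit Defensive.

Local Open Scope classical_set_scope.
Local Open Scope ring_scope.

(** Suppose that [Lambda] is not a limit of unstable compact minimal sets, so
    that every compact minimal set in some Hausdorff neighbourhood [W] of
    [Lambda] is stable.  Then [Lambda] has arbitrarily small neighbourhoods in
    CMin that are both compact and connected ([stable_nbhs_continuum]), which
    contradicts each of the three conditions.

    These neighbourhoods are continuous images of subsets of [M].  Since the
    orbit of every point of a minimal set [K] is dense in [K], and density up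
    to an error is an open condition on the point, a minimal set contained in
    a small neighbourhood of [K] is Hausdorff close to [K]: the neighbourhoods
    of [K] in CMin are described by its neighbourhoods in [M]
    ([cmin_nbhsP]).  One may thus work inside a compact neighbourhood [V] of
    [Lambda] all of whose minimal subsets lie in [W].  Stability of [Lambda],
    local connectedness of [M] and connectedness of [Lambda] give a positively
    invariant continuum [Q] in [V] that is a neighbourhood of [Lambda]
    ([stable_connected_nbhs]).  By Zorn's lemma the closure of the forward
    orbit of each [x] in [Q] contains a minimal set [f x] ([exists_cmin]), and
    [f x] is stable.  Once the orbit of [x] enters a small positively
    invariant neighbourhood of [f x], so do the orbits of all points [y] near
    [x], which forces [f y] to be close to [f x]: the map [f] is continuous
    ([limit_cmin_continuous]).  Hence [f @` Q] is compact and connected, and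
    it contains every minimal set [L] in [Q], as [f y = L] for [y] in [L]; so
    it is a neighbourhood of [Lambda] in CMin. *)

(** * Neighbourhoods of compact sets *)

Section compact_nbhs.
Context {R : realType} {M : metricType R}.
Implicit Types K N : set M.

Lemma nbhs_mdistE (x : M) N :
  nbhs x N <-> exists2 e : R, 0 < e & forall y, mdist x y < e -> N y.
Proof. by rewrite -(@metricType_numDomainType.filter_from_mdist_nbhs R M x). Qed.

Lemma compact_thickening K N : compact K -> K `<=` N° ->
  exists2 e : R, 0 < e & forall x y, K x -> mdist x y < e -> N y.
Proof.
move=> /compact_near_coveringP cK KN.
have : \forall e \near (0:R)^'+, K `<=` [set x | forall y, mdist x y < e -> N y].
  apply: cK => x /KN /nbhs_mdistE[r r0 rN].
  exists ([set z | mdist x z < r / 2], [set e | e < r / 2]) => /=.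
    split; first by apply/nbhs_mdistE; exists (r / 2) => //; exact: divr_gt0.
    by apply: nbhs_right_lt; exact: divr_gt0.
  move=> [z e] /= [xz er] y zy; apply: rN.
  by rewrite (le_lt_trans (metric_triangle x z y))// (splitr r) ltrD// (lt_trans zy).
move=> /(filterI (nbhs_right_gt 0))/filter_ex[e [e0 eK]].
by exists e => // x y /eK; exact.
Qed.

Lemma compact_nbhs_closed K N : compact K -> K `<=` N° ->
  exists N' : set M, [/\ closed N', K `<=` N'° & N' `<=` N].
Proof.
move=> cK /(compact_thickening cK)[e e0 eN].
pose D := [set y | exists2 x, K x & mdist x y < e / 2].
have e20 : 0 < e / 2 by exact: divr_gt0.
exists (closure D); split; first exact: closed_closure.
  move=> x Kx; apply: filterS (@subset_closure _ D) _.
  by apply/nbhs_mdistE; exists (e / 2) => // y xy; exists x.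
move=> z /(_ [set y | mdist z y < e / 2])[|y [[x Kx xy] zy]].
  by apply/nbhs_mdistE; exists (e / 2).
apply: (eN x) => //; apply: (le_lt_trans (metric_triangle x y z)).
by rewrite (splitr e) ltrD// metric_sym.
Qed.

(** Finitely many compact neighbourhoods of points cover [K].  The cover is
    extracted by compactness along the filter generated by the families of
    all supersets of a compact set, a filter because a union of two compact
    sets is compact. *)
Lemma compact_nbhs_compact K : locally_compact [set: M] -> compact K ->
  exists2 C, compact C & K `<=` C°.
Proof.
move=> lcM /compact_near_coveringP cK.
pose F : set_system (set M) := filter_from compact (fun C => [set D | C `<=` D]).
have FF : Filter F.
  apply: filter_from_filter; first by exists set0; exact: compact0.
  move=> C D cC cD; exists (C `|` D); first exact: compactU.
  by move=> E /= CDE; split; apply: subset_trans CDE => ? ?; [left|right].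
have [x Kx|C cC CK] := cK _ F (fun D x => nbhs x D) FF; last first.
  by exists C => //; exact: CK.
have [U xU [cU _]] := lcM x I.
exists (U°, [set D | U `<=` D]) => /=; last first.
  by move=> [y D] /= [Uy UD]; exact: filterS Uy.
split; last by exists U.
by apply: nbhs_interior; move: xU; rewrite withinET.
Qed.

(** The chain condition makes the families of supersets of members of [F] a
    filter, along which compactness picks a single member. *)
Lemma compact_chain_cover (F : set (set M)) (C : set M) :
  F !=set0 -> total_on F subset -> (forall U, F U -> open U) ->
  compact C -> C `<=` \bigcup_(U in F) U -> exists2 U, F U & C `<=` U.
Proof.
move=> F0 Ftot Fo /compact_near_coveringP cC CF.
pose G : set_system (set M) := filter_from F (fun U => [set V | U `<=` V]).
have FG : Filter G.
  apply: filter_from_filter => // U V FU FV.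
  have [UV|VU] := Ftot _ _ FU FV; [exists V|exists U] => // W /= h; split => //.
    exact: subset_trans h.
  exact: subset_trans h.
have [x Cx|U FU UC] := cC _ G (fun V x => V x) FG; last first.
  by exists U => //; exact: UC.
have [U FU Ux] := CF x Cx.
exists (U, [set V | U `<=` V]) => /=; last by move=> [y V] /= [Uy]; exact.
by split; [exact: open_nbhs_nbhs (conj (Fo _ FU) Ux)|exists U].
Qed.

End compact_nbhs.

(** * Orbits and minimal sets *)

Section flow.
Context {R : realType} {M : metricType R} {phi : R -> M -> M}.
Hypothesis hphi : C0_flow phi.
Implicit Types (x : M) (A K N P : set M) (L : cmin phi).

Lemma flow_continuous t : continuous (phi t).
Proof.
move=> x U xU; have [cphi _ _] := hphi.
have [[A B] /= [tA xB] ABU] := cphi (t, x) U xU.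
apply: filterS xB => y By; apply: (ABU (t, y)); split => //=.
exact: nbhs_singleton.
Qed.

Lemma orbit_continuous x : continuous (phi^~ x).
Proof.
move=> t U tU; have [cphi _ _] := hphi.
have [[A B] /= [tA xB] ABU] := cphi (t, x) U tU.
apply: filterS tA => s As; apply: (ABU (s, x)); split => //=.
exact: nbhs_singleton.
Qed.

Lemma flowD s t x : phi (s + t) x = phi s (phi t x).
Proof. by have [_ _ ->] := hphi. Qed.

Lemma flow0 x : phi 0 x = x.
Proof. by have [_ -> _] := hphi. Qed.

Lemma flowNK t : cancel (phi (- t)) (phi t).
Proof. by move=> x; rewrite -flowD subrr flow0. Qed.

Lemma closure_flow t A x :
  (forall y, A y -> A (phi t y)) -> closure A x -> closure A (phi t x).
Proof.
move=> At xA U /(flow_continuous (x := x)) /xA[y [Ay Uy]].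
by exists (phi t y); split=> //; exact: At.
Qed.

Definition forward_orbit x : set M := [set phi t x | t in [set t | 0 <= t]].

Lemma forward_orbit_refl x : forward_orbit x x.
Proof. by exists 0 => /=; rewrite ?flow0. Qed.

Lemma forward_orbit_positively_invariant x :
  positively_invariant phi (forward_orbit x).
Proof.
move=> t _ t0 [s /= s0 <-]; rewrite -flowD.
by exists (t + s) => //=; exact: addr_ge0.
Qed.

Lemma closure_positively_invariant P :
  positively_invariant phi P -> positively_invariant phi (closure P).
Proof. by move=> Pinv t x t0; apply: closure_flow => y; exact: Pinv. Qed.

Lemma forward_orbit_sub P x : positively_invariant phi P -> P x ->
  forward_orbit x `<=` P.
Proof. by move=> Pinv Px _ [t /= t0 <-]; exact: Pinv. Qed.

(** A point [w] of [A] is [phi t] of another point of [A], which is a limit of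
    the forward orbit of [x]; applying [phi t] turns that orbit into the one
    of [phi t x].  As [t] grows, this places [A] in the omega-limit set of
    [x]. *)
Lemma invariant_later_orbit A t x : flow_invariant phi A ->
  A `<=` closure (forward_orbit x) -> A `<=` closure (forward_orbit (phi t x)).
Proof.
move=> Ainv Ax w Aw U wU.
have : nbhs (phi (- t) w) (phi t @^-1` U).
  by apply: flow_continuous; rewrite flowNK.
move=> /(Ax _ (Ainv (- t) _ Aw))[_ [[s /= s0 <-] Us]].
exists (phi s (phi t x)); split; first by exists s.
by rewrite -flowD addrC flowD.
Qed.

Lemma cmin_sub_eq (K L : cmin phi) : cmin_set K `<=` cmin_set L -> K = L.
Proof.
move=> KL; apply: cmin_inj.
have [_ [K0 clK Kinv _]] := cminP K; have [_ [_ _ _]] := cminP L.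
by apply.
Qed.

Lemma cmin_orbit_closure L x : cmin_set L x ->
  closure (range (phi^~ x)) = cmin_set L.
Proof.
move=> Lx; have [_ [_ clL Linv]] := cminP L; apply.
- by exists x; apply: subset_closure; exists 0; rewrite ?flow0.
- exact: closed_closure.
- by move=> t y; apply: closure_flow => _ [s _ <-]; exists (t + s); rewrite ?flowD.
- by move/closure_id: clL => ->; apply: closureS => _ [t _ <-]; exact: Linv.
Qed.

Lemma cmin_connected L : connected L.
Proof.
have [x Lx] := cmin_nonempty L; rewrite -(cmin_orbit_closure Lx).
apply: connected_closure; apply: connected_continuous_connected.
  by apply/connected_intervalP => x0 y0 _ _ z _.
exact/continuous_subspaceT/orbit_continuous.
Qed.

(** Zorn's lemma gives a set that is minimal among the closed positively
    invariant sets meeting [C].  Each [phi t] with [0 <= t] maps it onto a set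
    of the same kind, hence onto itself, so it is invariant in both time
    directions. *)
Lemma exists_cmin (C : set M) : C !=set0 -> compact C ->
  positively_invariant phi C -> exists K : cmin phi, cmin_set K `<=` C.
Proof.
move=> C0 cC Cinv.
have clC : closed C by exact: compact_closed (@metric_hausdorff _ _) cC.
pose good (E : set M) := [/\ closed E, positively_invariant phi E & E `&` C !=set0].
(* [Zorn_bigcup] yields maximal sets, hence the complements. *)
have [F Fgood Ftot|U [Ugood Umax]] := @Zorn_bigcup M (fun U => good (~` U)).
  have [F0|/set0P/negP/negPn/eqP->] := pselect (F !=set0); last first.
    by rewrite bigcup_set0 setC0; split => //; rewrite setTI.
  split.
  - rewrite setC_bigcup; apply: closed_bigI => U FU.
    by have [] := Fgood _ FU.
  - rewrite setC_bigcup => t x t0 Fx U FU; have [_ + _] := Fgood _ FU.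
    by apply => //; exact: Fx.
  - apply: contrapT => FC.
    have [U FU|x Cx|U FU CU] := compact_chain_cover F0 Ftot _ cC.
    + by rewrite -[U]setCK openC; have [] := Fgood _ FU.
    + by apply: contrapT => Fx; apply: FC; exists x.
    + by have [_ _ [x [Ux /CU]]] := Fgood _ FU.
pose K := ~` U.
have Kmin E : good E -> E `<=` K -> E = K.
  move=> gE EK; apply: contrapT => neq; apply: (Umax (~` E)); last by rewrite setCK.
  split=> [x Ux /EK //|EU]; apply: neq; apply/seteqP; split=> // x Kx.
  by apply: contrapT => /EU.
have [clK Kinv KC0] := Ugood; rewrite -/K in clK Kinv KC0.
have KC : K `<=` C.
  rewrite -(Kmin (K `&` C)) => //; split.
  - exact: closedI.
  - by move=> t x t0 [Kx Cx]; split; [exact: Kinv|exact: Cinv].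
  - by rewrite -setIA setIid.
have cK : compact K by exact: subclosed_compact KC.
have K0 : K !=set0 by case: KC0 => x []; exists x.
have flowK t : 0 <= t -> phi t @` K = K.
  move=> t0; apply: Kmin; last by move=> _ [x Kx <-]; exact: Kinv.
  split.
  - apply: compact_closed; first exact: metric_hausdorff.
    by apply: continuous_compact cK; exact/continuous_subspaceT/flow_continuous.
  - move=> s _ s0 [x Kx <-]; exists (phi s x); first exact: Kinv.
    by rewrite -!flowD addrC.
  - by have [x Kx] := K0; exists (phi t x); split; [exists x|exact/KC/Kinv].
have Kflow : flow_invariant phi K.
  move=> t x Kx; have [t0|t0] := leP 0 t; first exact: Kinv.
  move: Kx; rewrite -{1}(flowK (- t)) ?oppr_ge0 ?ltW// => -[y Ky <-].
  by rewrite flowNK.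
have Kcmin : compact_minimal_set phi K.
  split=> //; split => // L L0 clL Linv LK; apply: Kmin => //; split => //.
  - by move=> t x _; exact: Linv.
  - by have [x Lx] := L0; exists x; split=> //; exact/KC/LK.
by exists (CMin Kcmin).
Qed.

(** * The Hausdorff topology on compact minimal sets *)

(** Only the upper half of the Hausdorff metric matters near a minimal set: if
    [L] is close to being contained in [K], then the orbit of a point of [L]
    follows for a while an orbit in [K], which is dense in [K]. *)
Lemma cmin_nbhsP (K : cmin phi) (W : set (cmin phi)) :
  nbhs K W <-> exists2 N, cmin_set K `<=` N° & forall L, cmin_set L `<=` N -> W L.
Proof.
have K0 := cmin_nonempty K; have cK := @cmin_compact _ _ _ K.
rewrite nbhs_mdistE; split=> [[e e0 eW]|[N KN NW]]; last first.
  have [e e0 eN] := compact_thickening cK KN.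
  exists e => // L KL; apply: NW => y Ly.
  have [|x Kx] := @dist_to_set_lt _ _ y K e K0.
    apply: le_lt_trans KL; rewrite le_max; apply/orP; right.
    by apply: hausdorff_excess_ub; [exact: cmin_nonempty|exact: cmin_compact| |].
  by rewrite metric_sym; exact: eN.
have e20 : 0 < e / 2 by exact: divr_gt0.
pose N1 := [set y | exists2 x, cmin_set K x & mdist x y < e / 2].
(* The points whose orbit is [e / 2]-dense along [K]; compactness of [K]
   makes this a neighbourhood of [K]. *)
pose N2 := [set y | cmin_set K `<=` [set x | exists t, mdist x (phi t y) < e / 2]].
exists (N1 `&` N2).
  move=> y Ky; apply: filterI.
    by apply/nbhs_mdistE; exists (e / 2) => // z yz; exists y.
  move: cK => /compact_near_coveringP cK; apply: cK => x Kx.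
  have e40 : 0 < e / 2 / 2 by exact: divr_gt0.
  move: Kx; rewrite -(cmin_orbit_closure Ky) => /(_ [set z | mdist x z < e / 2 / 2]).
  case=> [|_ [[t _ <-] /= xt]]; first by apply/nbhs_mdistE; exists (e / 2 / 2).
  have e80 : 0 < e / 2 / 2 / 2 by exact: divr_gt0.
  exists ([set x' | mdist x x' < e / 2 / 2 / 2],
    [set z | mdist (phi t y) (phi t z) < e / 2 / 2 / 2]) => /=.
    split; first by apply/nbhs_mdistE; exists (e / 2 / 2 / 2).
    apply: (@flow_continuous t y [set z | mdist (phi t y) z < e / 2 / 2 / 2]).
    by apply/nbhs_mdistE; exists (e / 2 / 2 / 2).
  move=> [x' z] /= [xx' yz]; exists t.
  rewrite (le_lt_trans (metric_triangle x' x _))// metric_sym.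
  rewrite (splitr (e / 2)) {1}(splitr (e / 2 / 2)) -addrA ltrD//.
  rewrite (le_lt_trans (metric_triangle x (phi t y) _))// addrC ltrD//.
move=> L LN; apply: eW; have [y Ly] := cmin_nonempty L.
have L0 := cmin_nonempty L.
apply: (@le_lt_trans _ _ (e / 2)); last by rewrite gtr_pMr// invf_lt1// ltr1n.
rewrite ge_max; apply/andP; split; apply: hausdorff_excess_le => //.
  move=> x Kx; have [_ /(_ x Kx)[t xt]] := LN y Ly.
  apply: le_trans (ltW xt); apply: dist_to_set_le.
  by have [_ [_ _ Linv _]] := cminP L; exact: Linv.
move=> z Lz; have [[x Kx xz] _] := LN z Lz.
apply: le_trans (ltW xz); rewrite metric_sym; exact: dist_to_set_le.
Qed.

(** * Stable minimal sets *)

(** The component of a positively invariant set that contains [K] is again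
    positively invariant, because it absorbs the orbit arcs starting in it,
    and it is a neighbourhood of [K] by local connectedness. *)
Lemma stable_connected_nbhs (K : cmin phi) V : locally_connected M ->
  lyapunov_stable phi K -> closed V -> cmin_set K `<=` V° ->
  exists Q : set M, [/\ closed Q, connected Q, positively_invariant phi Q,
    cmin_set K `<=` Q° & Q `<=` V].
Proof.
move=> lcM Kstable clV KV; have [P [KP PV Pinv]] := Kstable V KV.
have [x0 Kx0] := cmin_nonempty K; pose C := connected_component P x0.
have KC : cmin_set K `<=` C.
  apply: connected_component_max => //; last exact: cmin_connected.
  exact: subset_trans KP (@interior_subset _ P).
have Cinv : positively_invariant phi C.
  move=> t y t0 Cy; apply: (@connected_component_trans _ P y x0) => //.
  exists (phi^~ y @` [set s | 0 <= s <= t]).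
    split.
    - by exists 0; rewrite /= ?flow0 ?lexx.
    - move=> _ [s /andP[s0 _] <-]; apply: Pinv => //.
      exact: connected_component_sub Cy.
    - apply: connected_continuous_connected.
        apply/connected_intervalP => a b /= /andP[a0 _] /andP[_ bt] c.
        by move=> /andP[ac cb]; rewrite (le_trans a0 ac) (le_trans cb bt).
      exact/continuous_subspaceT/orbit_continuous.
  by exists t; rewrite /= ?t0 ?lexx.
exists (closure C); split.
- exact: closed_closure.
- exact/connected_closure/component_connected.
- exact: closure_positively_invariant.
- move=> x Kx; have [U [xU UP cU]] := lcM x P (KP x Kx).
  apply: filterS (xU) => y Uy; apply: subset_closure.
  apply: (@connected_component_trans _ P x x0); [exact: KC|exists U => //].
  by split => //; exact: nbhs_singleton xU.
- move/closure_id: clV => ->; apply: closureS.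
  by apply: subset_trans PV; exact: connected_component_sub.
Qed.

(** Let [P] be a small positively invariant neighbourhood of [f x].  The orbit
    of [x] enters the interior of [P] at some time [t], so [phi t y] is in [P]
    for [y] near [x]; the set [f y], being contained in the closure of the
    orbit of [phi t y], is then contained in the closure of [P]. *)
Lemma limit_cmin_continuous (f : M -> cmin phi) Q :
  (forall x, Q x -> cmin_set (f x) `<=` closure (forward_orbit x)) ->
  (forall x, Q x -> lyapunov_stable phi (f x)) ->
  {within Q, continuous f}.
Proof.
move=> flim fstable; apply/subspace_continuousP => x Qx W.
move=> /cmin_nbhsP[N fN NW].
have [N' [clN' fN' N'N]] := compact_nbhs_closed (@cmin_compact _ _ _ (f x)) fN.
have [P [fP PN' Pinv]] := fstable x Qx N' fN'.
have [z fz] := cmin_nonempty (f x).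
have [_ [[t t0 <-] Ptx]] := flim x Qx z fz _ (nbhs_interior (fP z fz)).
have xP : nbhs x (phi t @^-1` P) by exact: flow_continuous Ptx.
apply: filterS xP => y Pty Qy; apply: NW.
have [_ [_ _ fyinv _]] := cminP (f y).
apply: subset_trans (invariant_later_orbit t fyinv (flim y Qy)) _.
apply: subset_trans N'N; move/closure_id: clN' => ->; apply: closureS.
by apply: subset_trans PN'; exact: forward_orbit_sub.
Qed.

(** The neighbourhood is [f @` Q], for a positively invariant continuum [Q]
    around [K] and a map [f] choosing a minimal set in the closure of each
    forward orbit. *)
Lemma stable_nbhs_continuum (K : cmin phi) (W : set (cmin phi)) :
  locally_compact [set: M] -> locally_connected M ->
  nbhs K W -> (forall L, W L -> lyapunov_stable phi L) ->
  exists C, [/\ nbhs K C, C `<=` W, compact C & connected C].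
Proof.
move=> lkM lcM KW Wstable; have /cmin_nbhsP[N KN NW] := KW.
have cK := @cmin_compact _ _ _ K.
have [D cD KD] := compact_nbhs_compact lkM cK.
have [V [clV KV VND]] : exists V : set M,
    [/\ closed V, cmin_set K `<=` V° & V `<=` N `&` D].
  by apply: compact_nbhs_closed => // x Kx; apply: filterI; [exact: KN|exact: KD].
have Kstable := Wstable K (nbhs_singleton KW).
have [Q [clQ conQ Qinv KQ QV]] := stable_connected_nbhs lcM Kstable clV KV.
have QN : Q `<=` N by move=> x /QV/VND[].
have cQ : compact Q.
  by apply: subclosed_compact cD _ => // x /QV/VND[].
pose f x : cmin phi := xget K [set L | cmin_set L `<=` closure (forward_orbit x)].
have orbQ x : Q x -> closure (forward_orbit x) `<=` Q.
  move=> Qx; rewrite ((closure_id _).1 clQ); apply: closureS.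
  exact: forward_orbit_sub.
have flim x : Q x -> cmin_set (f x) `<=` closure (forward_orbit x).
  move=> Qx; have [|||L Lx] := @exists_cmin (closure (forward_orbit x)).
  - by exists x; apply: subset_closure; exact: forward_orbit_refl.
  - by apply: subclosed_compact cQ _; [exact: closed_closure|exact: orbQ].
  - exact/closure_positively_invariant/forward_orbit_positively_invariant.
  - exact: (xgetPex K (P := [set L | cmin_set L `<=` closure (forward_orbit x)])
      (ex_intro _ L Lx)).
have fW x : Q x -> W (f x).
  move=> Qx; apply: NW.
  exact: subset_trans (subset_trans (flim x Qx) (orbQ x Qx)) QN.
have fcont : {within Q, continuous f}.
  by apply: limit_cmin_continuous => // x Qx; exact/Wstable/fW.
exists (f @` Q); split.
- apply/cmin_nbhsP; exists Q => // L LQ; have [x Lx] := cmin_nonempty L.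
  exists x; first exact: LQ.
  (* The closure of the orbit of a point of [L] stays in [L]. *)
  apply: cmin_sub_eq; apply: subset_trans (flim x (LQ x Lx)) _.
  rewrite ((closure_id _).1 (@cmin_closed _ _ _ L)); apply: closureS.
  apply: forward_orbit_sub Lx => t y _.
  by have [_ [_ _ Linv _]] := cminP L; exact: Linv.
- by move=> _ [x Qx <-]; exact: fW.
- exact: continuous_compact.
- exact: connected_continuous_connected.
Qed.

End flow.

(** * Local connectedness of open subspaces *)

Lemma connected_subtype (T : topologicalType) (O C : set T) :
  C `<=` O -> connected C -> connected ((set_val : O -> T) @^-1` C).
Proof.
move=> CO cC B [b Bb] [_ [V oV <-] BV] [D].
rewrite -openC => -[W oW WD] BD.
have CVW : C `&` V = C `&` ~` W.
  apply/seteqP; split=> x [Cx xVW]; split=> //; pose y : O := SigSub (mem_set (CO x Cx)).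
  - have : B y by rewrite BV; split.
    by rewrite BD => -[_ Dy] Wx; have : (~` D) y by rewrite -WD.
  - suff : B y by rewrite BV => -[].
    rewrite BD; split=> //; apply: contrapT => Dy.
    by apply: xVW; have : (~` D) y by []; rewrite -WD.
have CV : C `&` V = C.
  apply: cC; last 2 first.
  - by exists V.
  - by exists (~` W) => //; exact: open_closedC.
  - by move: Bb; rewrite BV => -[Cb Vb]; exists (set_val b).
by rewrite BV -preimage_setI CV.
Qed.

Lemma open_locally_connected (T : topologicalType) (O : set T) :
  open O -> (forall x, O x -> locally_connected_at x) ->
  locally_connected (set_type O).
Proof.
move=> oO lc x U [_ [[A oA <-] /= Ax] AU].
have Ox : O (set_val x) by rewrite set_valE; apply: set_mem; exact: valP.
have [|V [xV VAO cV]] := lc _ Ox (A `&` O).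
  by apply: open_nbhs_nbhs; split; [exact: openI|].
exists (set_val @^-1` V); split.
- exact: initial_continuous.
- by move=> y /VAO[Ay _]; exact: AU.
- by apply: connected_subtype => // y /VAO[].
Qed.

Theorem corollary1 (R : realType) (M : metricType R) (phi : R -> M -> M)
    (hM : generalized_peano_continuum M) (hphi : C0_flow phi)
    (Lambda : cmin phi)
    (h : [\/ ~ locally_connected_at Lambda,
             ~ (exists N : set (cmin phi),
                  nbhs Lambda N /\ locally_connected (set_type N))
           | ~ (exists N : set (cmin phi), nbhs Lambda N /\ compact N)]) :
  closure (unstable_cmin phi) Lambda /\
  (forall N : set M, cmin_set Lambda `<=` N° ->
     exists K : cmin phi, unstable_cmin phi K /\ cmin_set K `<=` N).
Proof.
have [lkM _ lcM] := hM.
suff clU : closure (unstable_cmin phi) Lambda.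
  split=> // N LN; have [|K [Ku KN]] := clU [set K | cmin_set K `<=` N].
    by apply/cmin_nbhsP => //; exists N.
  by exists K.
apply: contrapT => nclU.
pose O := ~` closure (unstable_cmin phi).
have oO : open O by rewrite openC; exact: closed_closure.
have Ostable K : O K -> lyapunov_stable phi K.
  by move=> OK; apply: contrapT => uK; exact/OK/subset_closure.
have main K W : O K -> nbhs K W ->
    exists C, [/\ nbhs K C, C `<=` W, compact C & connected C].
  move=> OK KW.
  have [|L [_ /Ostable]|C [KC CWO cC conC]] :=
      @stable_nbhs_continuum _ _ _ hphi K (W `&` O) lkM lcM.
  - by apply: filterI => //; exact: open_nbhs_nbhs.
  - by [].
  - by exists C; split=> // L /CWO[].
have lcO K : O K -> locally_connected_at K.
  by move=> OK W /(main K W OK)[C [KC CW _ conC]]; exists C.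
case: h; apply.
- exact: lcO.
- by exists O; split; [exact: open_nbhs_nbhs|exact: open_locally_connected].
- by have [C [KC _ cC _]] := main Lambda setT nclU filterT; exists C.
Qed.
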